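(* Let $n\ge 2$ be an integer, let $p_1,p_2\ge 0$ with $p_1+p_2=1$, and let $r_1,r_2>0$ with $r_1\ne r_2$. If $p_1r_1\ge 2p_2r_2$, then the parameterized family of games get-close-to-one-of-two-targets with these $n,p_1,p_2,r_1,r_2$ (where the parameters $k_1,k_2$ are unknown to player 1) is BL-WoLF-learnable with loss $\lceil\log_2 n\rceil\, r_1$.
   Context: Stage game. There are two players, player 1 (the learner) and player 2 (the opponent), with finite action sets $A_1, A_2$. Each pair of actions determines a probability distribution over pairs of utilities; the expected utilities of the two players always sum to a constant. A stage-game strategy for player $i$ is a probability distribution over $A_i$. The value $V$ of the game is $V=\max_{\sigma_1}\min_{\sigma_2}E[u_1\mid\sigma_1,\sigma_2]$. Repeated game. A parameterized family of stage games consists of fixed action sets $A_1,A_2$, a parameter set $K$, and a map sending each $k\in K$ to a stage game with these action sets. One $k \in K$ is fixed, and the corresponding stage game is played over and over (random payoffs being drawn independently each round). Player 2 knows $k$ and player 1's learning strategy; player 1 knows only the family. After each round player 1 observes both actions and the payoffs of both players. A learning strategy for player 1 prescribes a stage-game strategy for each history of past actions and payoffs; the opponent may likewise use any history-dependent strategy. Player 1's loss in a round is $V$ (the value of the actual stage game) minus the utility player 1 received in that round; the loss incurred over several rounds is the sum of the losses of those rounds. BL-WoLF-learnability. A family is BL-WoLF-learnable with loss $l$ if there exists a learning strategy for player 1 such that, for any game in the family, against any opponent, and for any integer $N\ge 0$, player 1's expected cumulative loss over the first $N$ rounds is at most $l$. The family get-close-to-one-of-two-targets. For given $n,p_1,p_2,r_1,r_2$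 (known to both players, $r_1\neq r_2$), both players have action set $\{1,2,\ldots,n\}$. The game is determined by two parameters $k_1,k_2\in\{1,\ldots,n\}$ with $k_1\ne k_2$. Each round, Nature randomly chooses which of the two is active ($k_j$ is active with probability $p_j$). Given actions $a_1,a_2$ and the active target $k=k_j$ (and writing $-i$ for the player other than $i$): if $|a_i-k|<|a_{-i}-k|$, player $i$ wins; if $a_1=a_2=a\neq k$, player 1 wins if $a<k$ and player 2 wins if $a>k$; otherwise (i.e. $a_1-k=k-a_2$) there is a draw. When $k_j$ is active, the winner receives utility $r_j$ and the loser $0$; in a draw each player receives $r_j/2$. Player 1 initially does not know $k_1$ and $k_2$. *)

(* Defs.v *)
From HB Require Import structures.
From mathcomp Require Import all_boot all_order all_algebra finmap.
From mathcomp Require Import all_classical all_reals.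

Set Implicit Arguments.
Unset Strict Implicit.
Unset Printing Implicit Defensive.

Import Order.TTheory GRing.Theory Num.Theory.

Local Open Scope fset_scope.
Local Open Scope ring_scope.

Section FiniteDistributions.
Variable R : realType.

(* Finitely supported probability distributions on T. *)
Record fin_dist (T : choiceType) := FinDist {
  prob :> {fsfun T -> R with 0};
  prob_ge0 : forall x, 0 <= prob x;
  prob_sum1 : \sum_(x <- finsupp prob) prob x = 1 }.

Definition expectation (T : choiceType) (d : fin_dist T) (f : T -> R) : R :=
  \sum_(x <- finsupp d) d x * f x.

Lemma big_finsupp_widen (T : choiceType) (d : {fsfun T -> R with 0})
    (A : {fset T}) (f : T -> R) : finsupp d `<=` A ->
  \sum_(x <- finsupp d) d x * f x = \sum_(x <- A) d x * f x.
Proof.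
move=> dA; apply: (big_fset_incl _ dA) => x _ xd.
by rewrite fsfun_dflt// mul0r.
Qed.

Section Ret.
Variables (T : choiceType) (x : T).

Definition ret_fun : {fsfun T -> R with 0} := [fsfun y in [fset x] => 1 | 0].

Lemma ret_funE y : ret_fun y = (y == x)%:R.
Proof. by rewrite fsfun_fun inE; case: eqP. Qed.

Lemma finsupp_ret_fun : finsupp ret_fun = [fset x].
Proof.
by apply/fsetP => y; rewrite mem_finsupp ret_funE inE pnatr_eq0 eqb0 negbK.
Qed.

Lemma ret_fun_ge0 y : 0 <= ret_fun y. Proof. by rewrite ret_funE ler0n. Qed.

Lemma ret_fun_sum1 : \sum_(y <- finsupp ret_fun) ret_fun y = 1.
Proof. by rewrite finsupp_ret_fun big_seq_fset1 ret_funE eqxx. Qed.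

Definition dist_ret : fin_dist T := FinDist ret_fun_ge0 ret_fun_sum1.

Lemma expectation_ret f : expectation dist_ret f = f x.
Proof.
by rewrite /expectation /= finsupp_ret_fun big_seq_fset1 ret_funE eqxx mul1r.
Qed.

End Ret.

Section Bind.
Variables (T U : choiceType) (d : fin_dist T) (k : T -> fin_dist U).

Definition bind_supp : {fset U} := \bigcup_(x <- finsupp d) finsupp (k x).

Definition bind_fun : {fsfun U -> R with 0} :=
  [fsfun y in bind_supp => expectation d (fun x => k x y) | 0].

Lemma bind_funE y : bind_fun y = expectation d (fun x => k x y).
Proof.
rewrite fsfun_fun; case: ifPn => // yS; rewrite /expectation big_seq big1// => x xd.
rewrite (fsfun_dflt (f := k x)) ?mulr0//; apply: contra yS => yk.
by apply/bigfcupP; exists x; rewrite ?xd.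
Qed.

Lemma sum_bind_fun f : \sum_(y <- finsupp bind_fun) bind_fun y * f y =
  expectation d (fun x => expectation (k x) f).
Proof.
rewrite (@big_finsupp_widen _ _ bind_supp) ?finsupp_sub//.
under eq_bigr do rewrite bind_funE /expectation big_distrl /=.
rewrite exchange_big /= /expectation [LHS]big_seq [RHS]big_seq.
apply: eq_bigr => x xd; rewrite (@big_finsupp_widen _ _ bind_supp); last first.
  by apply: bigfcup_sup.
by rewrite big_distrr /=; apply: eq_bigr => y _; rewrite mulrA.
Qed.

Lemma bind_fun_ge0 y : 0 <= bind_fun y.
Proof.
by rewrite bind_funE; apply: sumr_ge0 => x _; rewrite mulr_ge0 ?prob_ge0.
Qed.

Lemma bind_fun_sum1 : \sum_(y <- finsupp bind_fun) bind_fun y = 1.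
Proof.
under eq_bigr do rewrite -[bind_fun _]mulr1.
rewrite (sum_bind_fun (fun=> 1)) -[RHS](prob_sum1 d); apply: eq_bigr => x _.
rewrite /expectation; under eq_bigr do rewrite mulr1.
by rewrite prob_sum1 mulr1.
Qed.

Definition dist_bind : fin_dist U := FinDist bind_fun_ge0 bind_fun_sum1.

Lemma expectation_bind f :
  expectation dist_bind f = expectation d (fun x => expectation (k x) f).
Proof. exact: sum_bind_fun. Qed.

End Bind.

(* true has probability p, false has probability q. *)
Section Coin.
Variables (p q : R) (p_ge0 : 0 <= p) (q_ge0 : 0 <= q) (pq1 : p + q = 1).

Definition coin_fun : {fsfun bool -> R with 0} :=
  [fsfun b in [fset true; false] => if b then p else q | 0].

Lemma coin_funE b : coin_fun b = if b then p else q.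
Proof. by rewrite fsfun_fun !inE; case: b. Qed.

Lemma sum_coin_fun f : \sum_(b <- finsupp coin_fun) coin_fun b * f b =
  p * f true + q * f false.
Proof.
rewrite (@big_finsupp_widen _ _ [fset true; false]) ?finsupp_sub//.
by rewrite big_fsetU1 ?inE//= big_seq_fset1 !coin_funE.
Qed.

Lemma coin_fun_ge0 b : 0 <= coin_fun b.
Proof. by rewrite coin_funE; case: b. Qed.

Lemma coin_fun_sum1 : \sum_(b <- finsupp coin_fun) coin_fun b = 1.
Proof.
under eq_bigr do rewrite -[coin_fun _]mulr1.
by rewrite (sum_coin_fun (fun=> 1)) !mulr1.
Qed.

Definition coin : fin_dist bool := FinDist coin_fun_ge0 coin_fun_sum1.

Lemma expectation_coin f : expectation coin f = p * f true + q * f false.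
Proof. exact: sum_coin_fun. Qed.

End Coin.
End FiniteDistributions.

Section RepeatedGames.
Variables (R : realType) (A1 A2 : finType).

Record stage_game := StageGame {
  payoffs : A1 -> A2 -> fin_dist R (R * R)%type;
  constant_sum : exists c, forall a1 a2,
    expectation (payoffs a1 a2) fst + expectation (payoffs a1 a2) snd = c }.

Definition expected_u1 (G : stage_game)
    (s1 : fin_dist R A1) (s2 : fin_dist R A2) : R :=
  expectation s1 (fun a1 => expectation s2 (fun a2 =>
    expectation (payoffs G a1 a2) fst)).

(* For nonempty finite action sets both extrema are attained, so the inf is a
   min and the sup is a max. *)
Definition value (G : stage_game) : R :=
  sup [set inf [set expected_u1 G s1 s2 | s2 in [set: fin_dist R A2]]
      | s1 in [set: fin_dist R A1]]%classic.

(* A round records both actions and the pair of realized payoffs, and nothing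
   else about how these payoffs were drawn; histories are in chronological
   order. *)
Definition round : choiceType := (A1 * A2 * (R * R))%type.
Definition history : choiceType := seq round.

Definition strategy (A : finType) := history -> fin_dist R A.

(* Law of the history of the first N rounds; given the past, the two players
   randomize independently. *)
Fixpoint play (G : stage_game) (s1 : strategy A1) (s2 : strategy A2) (N : nat)
    : fin_dist R history :=
  if N is N'.+1 then
    dist_bind (play G s1 s2 N') (fun h =>
    dist_bind (s1 h) (fun a1 =>
    dist_bind (s2 h) (fun a2 =>
    dist_bind (payoffs G a1 a2) (fun u =>
    dist_ret R (rcons h (a1, a2, u) : history)))))
  else dist_ret R ([::] : history).

Definition cumulative_loss (G : stage_game) (h : history) : R :=
  \sum_(x <- h) (value G - x.2.1).

Definition expected_loss (G : stage_game) (s1 : strategy A1) (s2 : strategy A2)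
    (N : nat) : R :=
  expectation (play G s1 s2 N) (cumulative_loss G).

(* The learning strategy is chosen knowing only the family F; the opponent is
   chosen afterwards, knowing both the parameter and that strategy. *)
Definition BL_WoLF_learnable (K : Type) (F : K -> stage_game) (l : R) : Prop :=
  exists s1 : strategy A1, forall (k : K) (s2 : strategy A2) (N : nat),
    expected_loss (F k) s1 s2 N <= l.

End RepeatedGames.

Section GetCloseToOneOfTwoTargets.
Variables (R : realType) (n : nat) (p1 p2 r1 r2 : R).
Hypotheses (p1_ge0 : 0 <= p1) (p2_ge0 : 0 <= p2) (p12 : p1 + p2 = 1).

(* Actions and targets 1, ..., n are encoded as 0, ..., n - 1 in 'I_n; the rules
   are invariant under this shift. *)
Definition distance (a k : 'I_n) : nat := `|a%:Z - k%:Z|%N.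

Definition target_payoffs (r : R) (k a1 a2 : 'I_n) : R * R :=
  if (distance a1 k < distance a2 k)%N then (r, 0)
  else if (distance a2 k < distance a1 k)%N then (0, r)
  else if (a1 == a2) && (a1 != k) then
    if (a1 < k)%N then (r, 0) else (0, r)
  else (r / 2, r / 2).

Definition two_targets := {k : 'I_n * 'I_n | k.1 != k.2}.

Definition get_close_payoffs (k : two_targets) (a1 a2 : 'I_n)
    : fin_dist R (R * R)%type :=
  dist_bind (coin p1_ge0 p2_ge0 p12) (fun first_active =>
    dist_ret R (if first_active then target_payoffs r1 (\val k).1 a1 a2
                else target_payoffs r2 (\val k).2 a1 a2)).

Lemma target_payoffs_sum r k a1 a2 :
  (target_payoffs r k a1 a2).1 + (target_payoffs r k a1 a2).2 = r.
Proof.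
rewrite /target_payoffs; do 4?case: ifP => _ /=; rewrite ?addr0 ?add0r//.
by rewrite -splitr.
Qed.

Lemma get_close_constant_sum (k : two_targets) : exists c, forall a1 a2,
  expectation (get_close_payoffs k a1 a2) fst +
  expectation (get_close_payoffs k a1 a2) snd = c.
Proof.
exists (p1 * r1 + p2 * r2) => a1 a2; rewrite !expectation_bind !expectation_coin.
by rewrite !expectation_ret addrACA -!mulrDr !target_payoffs_sum.
Qed.

Definition get_close_to_one_of_two_targets (k : two_targets)
    : stage_game R 'I_n 'I_n :=
  StageGame (get_close_constant_sum k).

End GetCloseToOneOfTwoTargets.

Arguments get_close_to_one_of_two_targets {R} n p1 p2 r1 r2 p1_ge0 p2_ge0 p12 k.

(* Main.v *)
(** The value of the game is [p1 r1 / 2], plus [p2 r2] when [k1 < k2]: both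
    players may as well play [k1].  In particular it is at most [p1 r1].

    The learner keeps the set [C] of targets compatible with the outcomes of
    the rounds in which the first target was active (recognizable, since the
    payoffs then sum to [r1] and not to [r2]), and plays a median of [C].  If
    she would not win outright with the first target active, then that outcome
    tells her on which side of her action [k1] lies, which halves [C]: the
    expected loss, at most [p1 r1], is paid for by the expected decrease of
    the potential [up_log 2 #|C| * r1].  If she would win, her expected utility
    is at least [p1 r1] already.  Once [C = {k1}] she plays [k1], which
    guarantees the value. *)

Require Import Defs.
From mathcomp Require Import all_boot all_order all_algebra finmap.
From mathcomp Require Import all_classical all_reals.
From mathcomp Require Import zify lra.

Import Order.TTheory GRing.Theory Num.Theory.
Local Open Scope ring_scope.

(** * Expectations and supports of finitely supported distributions *)

Section Expectation.
Context {R : realType}.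

Lemma le_expectation {T : choiceType} (d : fin_dist R T) (f g : T -> R) :
  (forall x, x \in finsupp d -> f x <= g x) ->
  expectation d f <= expectation d g.
Proof.
move=> fg; rewrite /expectation big_seq [leRHS]big_seq.
by apply: ler_sum => x xd; rewrite ler_wpM2l ?prob_ge0 ?fg.
Qed.

Lemma expectation_cst {T : choiceType} (d : fin_dist R T) (c : R) :
  expectation d (fun=> c) = c.
Proof. by rewrite /expectation -mulr_suml prob_sum1 mul1r. Qed.

Lemma expectationDl {T : choiceType} (d : fin_dist R T) (c : R) (f : T -> R) :
  expectation d (fun x => c + f x) = c + expectation d f.
Proof.
rewrite -[in RHS](expectation_cst d c) /expectation -big_split /=.
by apply: eq_bigr => x _; rewrite mulrDr.
Qed.

Lemma finsupp_bind {T U : choiceType} (d : fin_dist R T) (k : T -> fin_dist R U)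
    (y : U) :
  y \in finsupp (dist_bind d k) ->
  exists2 x, x \in finsupp d & y \in finsupp (k x).
Proof.
move=> /(fsubsetP (finsupp_sub _ _ _)) /bigfcupP[x].
by rewrite andbT => xd yk; exists x.
Qed.

Lemma finsupp_ret {T : choiceType} (x y : T) :
  y \in finsupp (dist_ret R x) -> y = x.
Proof. by rewrite /= finsupp_ret_fun inE => /eqP. Qed.

End Expectation.

(** * Bounds on the value and on the cumulative loss of a general stage game *)

Section RepeatedGames.
Context {R : realType} {A1 A2 : finType}.

(** Player 2 commits to the pure action [a2]. The inhabitant of [A1] makes the set under [sup]
    nonempty, and nonnegative payoffs make the sets under [inf] bounded below. *)
Lemma value_le (G : stage_game R A1 A2) (c : R) (a2 : A2) :
  A1 -> (forall a1 b2, 0 <= expectation (payoffs G a1 b2) fst) ->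
  (forall a1, expectation (payoffs G a1 a2) fst <= c) -> value G <= c.
Proof.
move=> a1 G_ge0 G_le; apply: ge_sup.
  by eexists; exists (dist_ret R a1).
move=> _ [s1 _ <-]; apply: (@le_trans _ _ (expected_u1 G s1 (dist_ret R a2))).
  apply: ge_inf; last by exists (dist_ret R a2).
  exists 0 => _ [s2 _ <-]; rewrite -(expectation_cst s1 0).
  apply: le_expectation => x _; rewrite -(expectation_cst s2 0).
  exact: le_expectation.
rewrite -(expectation_cst s1 c); apply: le_expectation => x _.
by rewrite expectation_ret.
Qed.

Lemma expected_loss_le_potential (G : stage_game R A1 A2)
    (s1 : history R A1 A2 -> A1) (s2 : strategy R A1 A2 A2)
    (P : history R A1 A2 -> Prop) (Phi : history R A1 A2 -> R) (N : nat) :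
  P [::] ->
  (forall h a2 u, P h -> u \in finsupp (payoffs G (s1 h) a2) ->
    P (rcons h (s1 h, a2, u))) ->
  (forall h, 0 <= Phi h) ->
  (forall h a2, P h ->
    expectation (payoffs G (s1 h) a2)
      (fun u => value G - u.1 + Phi (rcons h (s1 h, a2, u))) <= Phi h) ->
  expected_loss G (fun h => dist_ret R (s1 h)) s2 N <= Phi [::].
Proof.
move=> P0 PS Phi_ge0 PhiS; rewrite /expected_loss.
set s1' : strategy R A1 A2 A1 := fun h => _.
have Pplay M h : h \in finsupp (play G s1' s2 M) -> P h.
  elim: M h => [|M IHM] h /=; first by move=> /finsupp_ret ->.
  move=> /finsupp_bind[h' /IHM Ph'] /finsupp_bind[a1 /finsupp_ret ->].
  move=> /finsupp_bind[a2 _] /finsupp_bind[u uG] /finsupp_ret ->.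
  exact: PS.
apply: (@le_trans _ _ (expectation (play G s1' s2 N)
    (fun h => cumulative_loss G h + Phi h))).
  by apply: le_expectation => h _; rewrite lerDl.
elim: N => [|N IHN].
  by rewrite expectation_ret /cumulative_loss big_nil add0r.
apply: le_trans IHN; rewrite /= expectation_bind.
apply: le_expectation => h /Pplay Ph.
rewrite expectation_bind expectation_ret expectation_bind.
rewrite -[leRHS](expectation_cst (s2 h)); apply: le_expectation => a2 _.
rewrite expectation_bind.
under [X in expectation _ X]boolp.funext => u.
  rewrite expectation_ret /cumulative_loss -cats1 big_cat big_seq1 cats1 -addrA.
  over.
by rewrite expectationDl lerD2l PhiS.
Qed.

End RepeatedGames.

(** * Medians and halving *)

(** Take the least [m.+1] with more than half of [C] strictly below it: minimality bounds what lies
    below [m], and what lies above [m] is the complement of what lies below [m.+1]. *)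
Lemma median_exists (n : nat) (C : {set 'I_n}) : (0 < #|C|)%N ->
  exists m : 'I_n, (#|[set k in C | (k < m)%N]| <= #|C|./2)%N &&
                   (#|[set k in C | (m < k)%N]| <= #|C|./2)%N.
Proof.
move=> C_gt0.
pose below (m : nat) := [set k in C | (k < m)%N].
have ex_below : exists m, (#|C|./2 < #|below m|)%N.
  exists n; suff -> : below n = C by lia.
  by apply/setP => k; rewrite inE ltn_ord andbT.
case: (ex_minnP ex_below) => [[|m]] m_gt m_min.
  suff : #|below 0%N| = 0%N by lia.
  by apply/eqP; rewrite cards_eq0; apply/eqP/setP => k; rewrite !inE andbF.
have below_m : (#|below m| <= #|C|./2)%N.
  by rewrite leqNgt; apply/negP => /m_min; rewrite ltnn.
have mn : (m < n)%N.
  apply: leq_trans (m_min n _) => //; suff -> : below n = C by lia.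
  by apply/setP => k; rewrite inE ltn_ord andbT.
exists (Ordinal mn); apply/andP; split; first exact: below_m.
have : (#|below m.+1| + #|[set k in C | (m < k)%N]| = #|C|)%N.
  rewrite -(cardsID [set k : 'I_n | (k < m.+1)%N] C); congr addn;
    apply: eq_card => k; rewrite !inE //.
  by rewrite ltnS -ltnNge andbC.
move: m_gt => /=; lia.
Qed.

(** From [s <= 2 ^ e.+1] follows [t <= 2 ^ e]; the exponent is a successor because [1 < s]. *)
Lemma up_log2_half (s t : nat) : (1 < s)%N -> (t <= s./2)%N ->
  (up_log 2 t < up_log 2 s)%N.
Proof.
move=> s_gt1 ts; have := @up_logP 2 s isT.
have : (0 < up_log 2 s)%N by rewrite up_log_gt0.
case: (up_log 2 s) => // e _; rewrite expnS => se.
by rewrite ltnS up_log_min//; lia.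
Qed.

(** * Candidate targets and the potential *)

Section Learner.
Context {R : realType} {n : nat}.
Implicit Types (r : R) (k m a : 'I_n).

Lemma target_payoffs_ge0 r k a1 a2 : 0 <= r -> 0 <= (target_payoffs r k a1 a2).1.
Proof.
by move=> r0; rewrite /target_payoffs; do 4?case: ifP => _ /=; rewrite ?divr_ge0.
Qed.

Lemma target_payoffs_le r k a1 a2 : 0 <= r -> (target_payoffs r k a1 a2).1 <= r.
Proof.
by move=> r0; rewrite /target_payoffs; do 4?case: ifP => _ /=; lra.
Qed.

Lemma target_payoffs_at_target r k a : a != k -> (target_payoffs r k k a).1 = r.
Proof.
move=> ak; rewrite /target_payoffs /distance ifT//.
by move/eqP: ak => ak; have {}ak : nat_of_ord a <> k by [move=> /val_inj]; lia.
Qed.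

Lemma target_payoffs_vs_target r k a : a != k -> (target_payoffs r k a k).1 = 0.
Proof.
move=> ak; have {}ak : nat_of_ord a <> k by move=> /val_inj/eqP; apply/negP.
by rewrite /target_payoffs /distance ifN ?ifT//; lia.
Qed.

Lemma target_payoffs_same r k a : (target_payoffs r k a a).1 =
  if a == k then r / 2 else if (a < k)%N then r else 0.
Proof.
by rewrite /target_payoffs ltnn eqxx /=; case: eqP => //= _; case: ifP.
Qed.

(* The side of [m] on which [k] lies is given by [a] if [a != m], and by the
   outcome if [a = m]. *)
Lemma nonwin_side r k k' m a : 0 < r ->
  (target_payoffs r k m a).1 != r ->
  target_payoffs r k' m a = target_payoffs r k m a ->
  [\/ (k < m)%N /\ (k' < m)%N, (m < k)%N /\ (m < k')%N | k = m /\ k' = m].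
Proof.
move=> r_gt0.
(* The target is no closer to [m] than to [a]: at best it is their midpoint, still strictly on the
   side of [a]. *)
have side (j : 'I_n) : a != m -> (target_payoffs r j m a).1 != r ->
    if (a < m)%N then (j < m)%N else (m < j)%N.
  move=> am; have {}am : nat_of_ord a <> m by move=> /val_inj/eqP; apply/negP.
  rewrite /target_payoffs /distance; case: ifP => /= [|+ _]; first by rewrite eqxx.
  by case: ifP; lia.
case: (eqVneq a m) => [->|am] nwin out.
  (* With equal actions the learner gets [r / 2], [r] or 0, which are distinct as [0 < r]; not
     winning leaves [r / 2] and 0. *)
  move: nwin (congr1 fst out); rewrite !target_payoffs_same.
  case: (eqVneq m k) => [<-|mk]; case: (eqVneq m k') => [<-|mk'] => //.
  - by move=> _ _; constructor 3.
  - by move=> _; case: ifP => _; lra.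
  - by case: ifP => [|_ _]; rewrite ?eqxx//; lra.
  have mk1 : nat_of_ord m <> k by move=> /val_inj/eqP; apply/negP.
  have mk1' : nat_of_ord m <> k' by move=> /val_inj/eqP; apply/negP.
  case: ifP => [|km]; rewrite ?eqxx// => _; case: ifP => [_|km' _]; first lra.
  by constructor 1; lia.
have := side k am nwin; have := side k' am; rewrite out => /(_ nwin).
by case: ifP => _ ? ?; [constructor 1|constructor 2].
Qed.

Definition candidates r (h : history R 'I_n 'I_n) : {set 'I_n} :=
  [set k | all (fun x : round R 'I_n 'I_n => (x.2.1 + x.2.2 == r) ==>
                  (x.2 == target_payoffs r k x.1.1 x.1.2)) h].

Lemma candidates_nil r : candidates r [::] = [set: 'I_n].
Proof. by apply/setP => k; rewrite !inE. Qed.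

Lemma candidates_rcons r h a1 a2 u k :
  k \in candidates r (rcons h (a1, a2, u)) =
  ((u.1 + u.2 == r) ==> (u == target_payoffs r k a1 a2)) && (k \in candidates r h).
Proof. by rewrite !inE all_rcons. Qed.

Definition potential r h : R := (up_log 2 #|candidates r h|)%:R * r.

Lemma potential_rcons_le r h x : 0 <= r -> potential r (rcons h x) <= potential r h.
Proof.
move=> r0; rewrite ler_wpM2r// ler_nat leq_up_log// subset_leq_card//.
apply/fintype.subsetP => k.
by case: x => [[a1 a2] u]; rewrite candidates_rcons => /andP[].
Qed.

Definition median (a : 'I_n) (C : {set 'I_n}) : 'I_n :=
  odflt a [pick m : 'I_n | (#|[set k in C | (k < m)%N]| <= #|C|./2)%N &&
                           (#|[set k in C | (m < k)%N]| <= #|C|./2)%N].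

Lemma medianP a (C : {set 'I_n}) (m := median a C) : (0 < #|C|)%N ->
  (#|[set k in C | (k < m)%N]| <= #|C|./2)%N /\
  (#|[set k in C | (m < k)%N]| <= #|C|./2)%N.
Proof.
move=> /median_exists[m0 m0P]; rewrite /m /median.
by case: pickP => [? /andP[]|/(_ m0)] //; rewrite m0P.
Qed.

Lemma median1 a (C : {set 'I_n}) k : k \in C -> #|C| = 1%N -> median a C = k.
Proof.
move=> kC C1; have [|] := @medianP a C; first by rewrite C1.
rewrite C1 !leqn0 !cards_eq0 => /eqP/setP/(_ k) + /eqP/setP/(_ k).
by rewrite !inE kC /= => lt gt; apply/val_inj => /=; lia.
Qed.

(** The surviving candidates all lie strictly on the same side of the median as [k], or all equal
    it, so at most half survive and the logarithm drops by at least 1. *)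
Lemma potential_nonwin r h k a a2 (m := median a (candidates r h)) : 0 < r ->
  k \in candidates r h -> (1 < #|candidates r h|)%N ->
  (target_payoffs r k m a2).1 != r ->
  potential r (rcons h (m, a2, target_payoffs r k m a2)) + r <= potential r h.
Proof.
move=> r_gt0 kC C_gt1 nwin.
rewrite /potential -[X in _ + X]mul1r -mulrDl natr1 ler_pM2r// ler_nat.
have [le_lt le_gt] := medianP a _ (ltnW C_gt1).
apply: up_log2_half => //; set C' := candidates _ (rcons _ _).
have C'P k' : k' \in C' -> k' \in candidates r h /\
    [\/ (k < m)%N /\ (k' < m)%N, (m < k)%N /\ (m < k')%N | k = m /\ k' = m].
  rewrite candidates_rcons target_payoffs_sum eqxx /= => /andP[/eqP out ->].
  split=> //; exact: (nonwin_side _ _ _ _ _ r_gt0 nwin (esym out)).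
have [km|mk|km] := ltngtP k m.
- apply: leq_trans le_lt; apply/subset_leq_card/fintype.subsetP.
  move=> k' /C'P[k'C sides].
  rewrite inE k'C; case: sides => [[_ ->]//|[mk _]|[kmE _]]; first lia.
  by rewrite kmE ltnn in km.
- apply: leq_trans le_gt; apply/subset_leq_card/fintype.subsetP.
  move=> k' /C'P[k'C sides].
  rewrite inE k'C; case: sides => [[km _]|[_ ->]//|[kmE _]]; first lia.
  by rewrite kmE ltnn in mk.
(* A lone survivor is at most half of [C], since [C] had at least two elements. *)
apply: (@leq_trans #|[set m]|); last by rewrite cards1; lia.
apply/subset_leq_card/fintype.subsetP => k' /C'P[_ sides]; rewrite inE.
by case: sides => [[]|[]|[_ ->]]//; rewrite km ltnn.
Qed.

End Learner.

Theorem theorem7 (R : realType) (n : nat) (p1 p2 r1 r2 : R)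
    (n_ge2 : (2 <= n)%N)
    (p1_ge0 : 0 <= p1) (p2_ge0 : 0 <= p2) (p12 : p1 + p2 = 1)
    (r1_gt0 : 0 < r1) (r2_gt0 : 0 < r2) (r12 : r1 <> r2)
    (hpr : 2 * p2 * r2 <= p1 * r1) :
  BL_WoLF_learnable
    (get_close_to_one_of_two_targets n p1 p2 r1 r2 p1_ge0 p2_ge0 p12)
    ((up_log 2 n)%:R * r1).
Proof.
have a0 : 'I_n by exists 0%N; apply: ltnW.
pose s1 h := median a0 (candidates r1 h).
exists (fun h => dist_ret R (s1 h)) => -[[k1 k2] /= k12] s2 N.
set G := get_close_to_one_of_two_targets _ _ _ _ _ _ _ _ _.
have GE a1 a2 f : expectation (payoffs G a1 a2) f =
    p1 * f (target_payoffs r1 k1 a1 a2) + p2 * f (target_payoffs r2 k2 a1 a2).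
  by rewrite expectation_bind expectation_coin !expectation_ret.
have r1_ge0 := ltW r1_gt0; have r2_ge0 := ltW r2_gt0.
have u1_ge0 a1 a2 : 0 <= p1 * (target_payoffs r1 k1 a1 a2).1.
  by rewrite mulr_ge0 ?target_payoffs_ge0.
have u2_ge0 a1 a2 : 0 <= p2 * (target_payoffs r2 k2 a1 a2).1.
  by rewrite mulr_ge0 ?target_payoffs_ge0.
(* The learner's expected utility when both players play [k1]. *)
pose V : R := p1 * (r1 / 2) + p2 * (if (k1 < k2)%N then r2 else 0).
(* By [hpr], the second term is at most [p1 * r1 / 2]. *)
have V_le : V <= p1 * r1.
  by rewrite /V; case: ifP => _; have := mulr_ge0 p1_ge0 r1_ge0; lra.
have valueV : value G <= V.
  apply: (value_le _ _ k1) => // [a1 a2|a1].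
    by rewrite GE addr_ge0.
  rewrite GE; have [->|a1k] := eqVneq a1 k1.
    by rewrite !target_payoffs_same eqxx (negbTE k12).
  (* Leaving [k1] forfeits the first target, so at most [p2 * r2 <= p1 * r1 / 2] remains. *)
  rewrite target_payoffs_vs_target// mulr0 add0r.
  have : p2 * (target_payoffs r2 k2 a1 k1).1 <= p2 * r2.
    by rewrite ler_wpM2l ?target_payoffs_le.
  have : 0 <= p2 * (if (k1 < k2)%N then r2 else 0).
    by rewrite mulr_ge0//; case: ifP.
  by rewrite /V; lra.
have -> : (up_log 2 n)%:R * r1 = potential r1 ([::] : history R 'I_n 'I_n).
  by rewrite /potential candidates_nil cardsT card_ord.
apply: (expected_loss_le_potential _ _ _ (fun h => k1 \in candidates r1 h)).
- by rewrite candidates_nil inE.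
- move=> h a2 u k1C /finsupp_bind[b _ /finsupp_ret ->].
  (* When the second target is active the payoffs sum to [r2], not [r1], so the round excludes no
     candidate. *)
  rewrite candidates_rcons k1C andbT; case: b; rewrite target_payoffs_sum.
    by rewrite !eqxx.
  by rewrite eq_sym; move/eqP: r12 => /negbTE ->.
- by move=> h; rewrite mulr_ge0.
move=> h a2 k1C; rewrite GE.
set t1 := target_payoffs r1 _ _ _; set t2 := target_payoffs r2 _ _ _.
set Phi1 := potential _ (rcons _ (_, t1)); set Phi2 := potential _ (rcons _ (_, t2)).
have Phi1_le : p1 * Phi1 <= p1 * potential r1 h.
  by rewrite ler_wpM2l ?potential_rcons_le.
have Phi2_le : p2 * Phi2 <= p2 * potential r1 h.
  by rewrite ler_wpM2l ?potential_rcons_le.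
have u1 : 0 <= p1 * t1.1 := u1_ge0 _ _.
have u2 : 0 <= p2 * t2.1 := u2_ge0 _ _.
have sumE x : p1 * x + p2 * x = x by rewrite -mulrDl p12 mul1r.
(* These equations let [lra] treat the products with [p1] and [p2] as atoms. *)
have valueE := sumE (value G); have potE := sumE (potential r1 h).
have [win|nwin] := eqVneq t1.1 r1.
  by move: u1 u2; rewrite win => *; lra.
have [C_gt1|] := ltnP 1 #|candidates r1 h|.
  have : p1 * (Phi1 + r1) <= p1 * potential r1 h.
    by rewrite ler_wpM2l// potential_nonwin.
  lra.
have C_gt0 : (0 < #|candidates r1 h|)%N by apply/card_gt0P; exists k1.
move=> C_le1; have s1h : s1 h = k1 by apply: median1 => //; lia.
(* Any other action would let the learner, who plays [k1], win the first target. So both play [k1],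
   and the round yields exactly [V]. *)
have a2k : a2 = k1.
  apply/eqP; apply: contraNT nwin => a2k.
  by rewrite /t1 s1h target_payoffs_at_target.
have t1E : t1.1 = r1 / 2 by rewrite /t1 s1h a2k target_payoffs_same eqxx.
have t2E : t2.1 = if (k1 < k2)%N then r2 else 0.
  by rewrite /t2 s1h a2k target_payoffs_same (negbTE k12).
by move: valueV; rewrite /V -t1E -t2E; lra.
Qed.
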